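(* Let $f\in C^1(\mathbb{R}^n)$ satisfy $\inf_{\mathbb{R}^n}f>0$ and $\operatorname{supp}\nabla f\subset B_{R_1}$ for some constant $R_1>1$, where $B_{R_1}=\{x\in\mathbb{R}^n:|x|<R_1\}$. Let $0<g\in C^2((-\infty,1))$ satisfy $g'(s)\le 0$ for all $s<1$. Then for any $\lambda>0$ there does not exist any bounded solution $w$ of the problem $$-\Delta w=\frac{\lambda f(x)}{g(w)},\quad w<1,\qquad\text{in }\mathbb{R}^n.$$
   Context: A solution means a function $w\in C^2(\mathbb{R}^n)$ with $w<1$ satisfying the equation pointwise in $\mathbb{R}^n$; bounded means $\sup_{\mathbb{R}^n}|w|<\infty$. *)

(* Defs.v *)
From mathcomp Require Import all_boot all_order all_algebra.
From mathcomp Require Import all_classical all_reals all_analysis.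
Import Order.TTheory GRing.Theory Num.Theory.
Import numFieldNormedType.Exports.

Set Implicit Arguments.
Unset Strict Implicit.
Unset Printing Implicit Defensive.

Local Open Scope ring_scope.
Local Open Scope classical_set_scope.

(* R^n is 'rV[R]_n; the library norm on it is the sup norm, hence an explicit
   Euclidean norm for balls. The topology is the same for both norms. *)
Definition enorm (R : realType) (n : nat) (x : 'rV[R]_n) : R :=
  Num.sqrt (\sum_(i < n) x 0 i ^+ 2).

Definition eball (R : realType) (n : nat) (r : R) : set 'rV[R]_n :=
  [set x | enorm x < r].

Definition basis_vec (R : realType) (n : nat) (i : 'I_n) : 'rV[R]_n :=
  delta_mx 0 i.

Definition partial (R : realType) (n : nat) (i : 'I_n) (u : 'rV[R]_n -> R) :
  'rV[R]_n -> R := fun x => 'D_(basis_vec R i) u x.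

Definition grad (R : realType) (n : nat) (u : 'rV[R]_n -> R) (x : 'rV[R]_n) :
  'rV[R]_n := \row_(i < n) partial i u x.

Definition laplacian (R : realType) (n : nat) (u : 'rV[R]_n -> R)
  (x : 'rV[R]_n) : R := \sum_(i < n) partial i (partial i u) x.

(* u is of class C^k on R^n: all iterated partial derivatives of u of order at
   most k exist everywhere and are continuous. Existence has to be required
   separately because 'D_v is a total operator. *)
Fixpoint Ck (R : realType) (n k : nat) (u : 'rV[R]_n -> R) : Prop :=
  continuous u /\
  (if k is k'.+1 then
     forall i : 'I_n,
       (forall x, derivable u x (basis_vec R i)) /\ Ck k' (partial i u)
   else True).

(* g is of class C^k on the open set A of the real line; the values of g
   outside A are irrelevant. *)
Definition Ck_on (R : realType) (k : nat) (A : set R) (g : R -> R) : Prop :=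
  (forall j : nat, (j < k)%N -> forall s, A s -> derivable g^`(j) s 1) /\
  (forall j : nat, (j <= k)%N -> forall s, A s -> {for s, continuous g^`(j)}).

Definition supp (R : realType) (n : nat) (F : 'rV[R]_n -> 'rV[R]_n) :
  set 'rV[R]_n := closure [set x | F x != 0].

Definition is_solution (R : realType) (n : nat) (lambda : R)
    (f : 'rV[R]_n -> R) (g : R -> R) (w : 'rV[R]_n -> R) : Prop :=
  [/\ Ck 2 w,
      forall x, w x < 1 &
      forall x, - laplacian w x = lambda * f x / g (w x)].

Definition is_bounded (R : realType) (n : nat) (w : 'rV[R]_n -> R) : Prop :=
  (ereal_sup (range (fun x => `|w x|%:E)) < +oo)%E.

(* Main.v *)
(* Since w is bounded and g is positive and nonincreasing, -Δw is bounded below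
   by a positive constant c.  Then v = w + a|x|^2 with 0 < 2na < c satisfies
   Δv < 0, yet v tends to infinity, so it attains a global minimum, at which
   all pure second derivatives are nonnegative: a contradiction. *)
Require Import Defs.
From mathcomp Require Import all_boot all_order all_algebra.
From mathcomp Require Import all_classical all_reals all_analysis.
From mathcomp Require Import ring lra.
Import Order.TTheory GRing.Theory Num.Theory.
Import numFieldNormedType.Exports.
Local Open Scope ring_scope.
Local Open Scope classical_set_scope.

(** At the minimum [q 0 = 0]. If [l < 0], the difference quotients of [q] at 0 are negative near 0,
    so [q < 0] just to the right of 0, and the mean value theorem pushes [p] below [p 0] there. *)
Lemma second_derivative_min_ge0 (R : realType) (p q : R -> R) (l : R) :
  (forall t : R, is_derive t 1 p (q t)) -> is_derive (0 : R) 1 q l ->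
  (forall t, p 0 <= p t) -> 0 <= l.
Proof.
move=> dp [dq ql] pmin; rewrite leNgt; apply/negP => l_lt0.
have q0 : q 0 = 0.
  have d0 : is_derive (0 : R) 1 p 0.
    apply: (@derive1_at_min _ p (-1) 1 0) => //.
    by rewrite in_itv /=; apply/andP; split; lra.
  by case: (dp 0) => _ <-; case: d0.
have /cvgr_lt /(_ _ l_lt0) :
    h^-1 *: ((q \o shift 0) (h *: 1) - q 0) @[h --> 0^'] --> l.
  by rewrite -ql; exact: dq.
rewrite q0 => -[e /= e0 He].
have [c] : exists2 c, c \in `]0, (e / 2)[%R &
    p (e / 2) - p 0 = q c * (e / 2 - 0).
  apply: MVT => //; first by rewrite divr_gt0.
  by apply: derivable_within_continuous => t _; case: (dp t).
rewrite in_itv /= => /andP[c0 ce] E.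
have : c^-1 *: ((q \o shift 0) (c *: 1) - 0) < 0.
  apply: He; last by rewrite gt_eqF.
  by rewrite /= sub0r normrN gtr0_norm //; lra.
rewrite /= addr0 subr0 [c *: 1]mulr1 => H.
have qc : q c < 0 by move: H; rewrite /GRing.scale /= pmulr_rlt0 // invr_gt0.
have := pmin (e / 2); rewrite -subr_ge0 E subr0 pmulr_lge0 ?divr_gt0 //.
by rewrite leNgt qc.
Qed.

(** Both difference quotients are the same function of [h], so existence and value of the derivative
    transfer together. This reduces second partials to the one-variable test above. *)
Lemma is_derive_line (R : realType) (n : nat) (u : 'rV[R]_n -> R)
    (x e : 'rV[R]_n) (t : R) :
  derivable u (x + t *: e) e ->
  is_derive t 1 (fun s => u (x + s *: e)) ('D_e u (x + t *: e)).
Proof.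
have E : (fun h : R => h^-1 *: (((fun s => u (x + s *: e)) \o shift t) (h *: 1)
            - u (x + t *: e))) =
         (fun h => h^-1 *: ((u \o shift (x + t *: e)) (h *: e)
            - u (x + t *: e))).
  apply/funext => h /=; congr (_ *: (u _ - _)).
  by rewrite [h *: 1]mulr1 scalerDl addrCA.
by move=> du; apply: DeriveDef; rewrite ?/derivable ?/derive E.
Qed.

Definition sqnorm {R : realType} {n : nat} (x : 'rV[R]_n) : R :=
  \sum_(i < n) x 0 i ^+ 2.

Lemma sqnorm_line (R : realType) (n : nat) (x : 'rV[R]_n) (i : 'I_n) (t : R) :
  sqnorm (x + t *: basis_vec R i) = sqnorm x + (2 * x 0 i * t + t ^+ 2).
Proof.
rewrite /sqnorm (bigD1 i) //= [in RHS](bigD1 i) //= !mxE !eqxx /=.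
rewrite (eq_bigr (fun j => x 0 j ^+ 2)).
  by ring.
by move=> j /negPf ji; rewrite !mxE eqxx ji /= mulr0 addr0.
Qed.

Lemma continuous_sqnorm (R : realType) (n : nat) :
  continuous (@sqnorm R n).
Proof.
move=> x; have F := nbhs_filter x.
apply: cvg_big => [y|i _]; first exact: add_continuous.
by apply: cvgM; exact: coord_continuous.
Qed.

(** Coercivity: on a large enough compact cube the minimum exists, and outside it the quadratic term
    outweighs the oscillation of [w], which is at most [2 * M]. *)
Lemma sqnorm_min_attained (R : realType) (n : nat) (w : 'rV[R]_n -> R)
    (a M : R) :
  continuous w -> 0 < a -> (forall x, `|w x| <= M) ->
  exists x0, forall x, w x0 + a * sqnorm x0 <= w x + a * sqnorm x.
Proof.
move=> cw a0 wM; set v := fun x => w x + a * sqnorm x.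
have M0 : 0 <= M by apply: le_trans (wM 0).
have cv : continuous v.
  move=> x; have F := nbhs_filter x; apply: cvgD; first exact: cw.
  by apply: cvgM; [exact: cvg_cst|exact: continuous_sqnorm].
(* Chosen so that [a * r = a + 2 * M]; the summand 1 also gives [r <= r ^+ 2]. *)
pose r := 1 + 2 * M / a.
have r1 : 1 <= r by rewrite lerDl divr_ge0 ?mulr_ge0 // ltW.
have ar : 2 * M < a * r ^+ 2.
  apply: (@lt_le_trans _ _ (a * r)).
    by rewrite mulrDr mulr1 mulrCA mulfV ?gt_eqF // mulr1; lra.
  by rewrite ler_pM2l // expr2 ler_peMr //; lra.
pose A := [set x : 'rV[R]_n | forall i, `[- r, r] (x ord0 i)].
have A0 : A 0 by move=> i; rewrite mxE /= in_itv /= oppr_le0; apply/andP; split; lra.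
have [x0 x0A x0min] : exists2 c, c \in A & forall x, x \in A -> v c <= v x.
  apply: EVT_min_rV; first by exists 0.
    by apply: (@rV_compact _ _ (fun=> `[- r, r])) => i; exact: segment_compact.
  exact: continuous_subspaceT.
exists x0 => x; rewrite -/(v x0) -/(v x).
have [xA|xA] := boolP (x \in A); first exact: x0min.
(* The origin lies in the cube and [v 0 = w 0]. *)
have v0 : v x0 <= M.
  apply: le_trans (x0min 0 (mem_set A0)) _.
  rewrite /v /sqnorm big1 ?mulr0 ?addr0; first exact: le_trans (ler_norm _) (wM 0).
  by move=> i _; rewrite mxE expr0n.
apply: le_trans v0 _.
(* A single coordinate outside [[- r, r]] already forces [a * sqnorm x > 2 * M], hence [v x > M]. *)
have [i xi] : exists i, ~ `[- r, r] (x 0 i).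
  by apply/existsNP => H; move/negP: xA; apply; exact: mem_set.
have rx : r ^+ 2 <= x 0 i ^+ 2.
  rewrite -[x 0 i ^+ 2]real_normK ?num_real // ler_sqr ?nnegrE //; last by lra.
  rewrite leNgt; apply/negP => xr; apply: xi; rewrite /= in_itv /= -ler_norml.
  exact: ltW.
have : a * r ^+ 2 <= a * sqnorm x.
  rewrite ler_pM2l //; apply: le_trans rx _; rewrite /sqnorm (bigD1 i) //= lerDl.
  by apply: sumr_ge0 => j _; exact: sqr_ge0.
by have := wM x; rewrite ler_norml /v => /andP[]; lra.
Qed.

Lemma no_bounded_uniformly_superharmonic (R : realType) (n : nat)
    (w : 'rV[R]_n -> R) (c M : R) :
  Ck 2 w -> (forall x, `|w x| <= M) -> 0 < c ->
  ~ (forall x, c <= - laplacian w x).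
Proof.
move=> [cw dw] wM c0 Lw.
(* This gives [2 * n * a < c]; the successor keeps the denominator nonzero for every [n]. *)
pose a := c / (4 * n.+1%:R).
have a0 : 0 < a by rewrite divr_gt0 // mulr_gt0.
have [x0 x0min] := @sqnorm_min_attained R n w a M cw a0 wM.
have second_ge0 i : 0 <= partial i (partial i w) x0 + 2 * a.
  have [dwi [_ /(_ i)[ddwi _]]] := dw i.
  pose e := basis_vec R i.
  (* The restriction of [w + a * sqnorm] to the [i]-th coordinate line through [x0], up to the
     constant [a * sqnorm x0]; [q] is its derivative. *)
  pose p t := w (x0 + t *: e) + a * (2 * x0 0 i * t + t ^+ 2).
  pose q t := partial i w (x0 + t *: e) + a * (2 * x0 0 i + 2 * t).
  apply: (@second_derivative_min_ge0 R p q).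
  - move=> t; apply: is_deriveD; first exact: is_derive_line.
    apply: is_derive_eq.
    by rewrite /GRing.scale /=; ring.
  - rewrite (_ : partial i (partial i w) x0 =
        'D_e (partial i w) (x0 + 0 *: e)); last by rewrite scale0r addr0.
    apply: is_deriveD; first by exact: is_derive_line.
    apply: is_derive_eq.
    by rewrite /GRing.scale /=; ring.
  - move=> t; have := x0min (x0 + t *: e).
    rewrite sqnorm_line /p scale0r addr0 mulr0 expr0n /= addr0 mulr0 addr0.
    by rewrite mulrDr; lra.
(* Summing over [i] bounds [- laplacian w x0] by [2 * n * a], which is less than [c]. *)
have : 0 <= laplacian w x0 + n%:R * (2 * a).
  rewrite mulr_natl -[X in _ *+ X]card_ord -sumr_const -big_split /=.
  by apply: sumr_ge0 => i _; exact: second_ge0.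
have E : a * (4 * n.+1%:R) = c by rewrite divfK // gt_eqF // mulr_gt0.
have := Lw x0; have : 0 <= n%:R * a by rewrite mulr_ge0 // ltW.
move: E; rewrite -natr1; nra.
Qed.

Theorem corollary1p4 (R : realType) (n : nat) (n_gt0 : (0 < n)%N)
    (f : 'rV[R]_n -> R) (R1 : R) (g : R -> R)
    (f_C1 : Ck 1 f)
    (f_inf : (0 < ereal_inf (range (fun x => (f x)%:E)))%E)
    (R1_gt1 : 1 < R1)
    (f_supp : supp (grad f) `<=` @eball R n R1)
    (g_C2 : Ck_on 2 [set s | s < 1] g)
    (g_gt0 : forall s, s < 1 -> 0 < g s)
    (g_noninc : forall s, s < 1 -> g^`() s <= 0)
    (lambda : R) (lambda_gt0 : 0 < lambda) :
  ~ exists w : 'rV[R]_n -> R, is_solution lambda f g w /\ is_bounded w.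
Proof.
move=> [w [[w_C2 w_lt1 w_eq] w_bd]].
have [M wM] : exists M, forall x, `|w x| <= M.
  move: w_bd; rewrite /is_bounded.
  case: (ereal_sup _) (@ereal_sup_ubound R (range (fun x => `|w x|%:E)))
    => [M||] ub lt_oo.
  - by exists M => x; rewrite -lee_fin; apply: ub; exists x.
  - by rewrite ltxx in lt_oo.
  (* The witness is arbitrary: any point [x] refutes a supremum equal to [-oo]. The infimum [+oo]
     below is refuted likewise. *)
  - by exists 0 => x; suff : (`|w x|%:E <= -oo)%E by []; apply: ub; exists x.
have [m m0 fm] : exists2 m, 0 < m & forall x, m <= f x.
  case: (ereal_inf _) f_inf (@ereal_inf_lbound R (range (fun x => (f x)%:E)))
    => [m||] // m0 lb.
  - by exists m => // x; rewrite -lee_fin; apply: lb; exists x.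
  - by exists 1 => // x; suff : (+oo <= (f x)%:E)%E by []; apply: lb; exists x.
have wNM x : - M <= w x by have := wM x; rewrite ler_norml => /andP[].
(* Places [- M] in the domain where [g] is known to be positive. *)
have NM1 : - M < 1 by exact: le_lt_trans (wNM 0) (w_lt1 0).
(* Monotonicity is applied on the ray up to [w x], which stays inside [s < 1]. *)
have gM x : g (w x) <= g (- M).
  apply: (@ler0_derive1_nincrNy _ g (w x)) => //.
  - move=> s; rewrite in_itv /= => sw.
    exact: (g_C2.1 0 isT s (lt_trans sw (w_lt1 x))).
  - by move=> s; rewrite in_itv /= => sw; exact/g_noninc/(lt_trans sw).
  - apply: continuous_in_subspaceT => s; rewrite inE /= in_itv /= => sw.
    exact: (g_C2.2 0 isT s (le_lt_trans sw (w_lt1 x))).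
(* The constant combines the least numerator [lambda * m] with the largest denominator [g (- M)]. *)
apply: (@no_bounded_uniformly_superharmonic R n w (lambda * m / g (- M)) M) => //.
- by rewrite divr_gt0 ?mulr_gt0 // g_gt0.
- move=> x; rewrite w_eq; apply: ler_pM.
  + by rewrite mulr_ge0 // ltW.
  + by rewrite invr_ge0 ltW // g_gt0.
  + by rewrite ler_pM2l.
  + by rewrite lef_pV2 ?posrE ?g_gt0.
Qed.
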